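(* Let $N\ge 4$ and suppose that $I_N\otimes A_1+\Gamma\otimes A_{12}$ is stable, where $\Gamma=\Gamma_{N\times N}$ is the outer coupling matrix defined in the context. Consider the network $$\dot x=(I_N\otimes A_1+\Gamma\otimes A_{12})x+(E_N\otimes B_1)w_1,\qquad y=(E_N^T\otimes C_1)x .\qquad (\ast)$$ (i) If $N$ is even, then the $H_2$ norm of $(\ast)$ is equal to the $H_2$ norm of the system $$\dot\xi=(I_{N/2}\otimes A_1+J_{N/2}\otimes A_{12})\xi+B_{N/2}\,w,\qquad y=C_{N/2}\,\xi ,$$ where the matrices $C_k,B_k$ ($k\ge 2$, with $k$ blocks each) are defined inductively by $$C_2^{\,\mathrm{blk}}=(2C_1,\ 0),\qquad C_k^{\,\mathrm{blk}}=\bigl(C_{k-1}^{\,\mathrm{blk}},\ (-1)^{k-1}2^{k-2}C_1\bigr)\quad (k\ge 3),$$ with $C_{N/2}:=C_{N/2}^{\,\mathrm{blk}}$, and $B_k=b^{(k)}\otimes B_1$, where $b^{(2)}=(2,1)^T$, $b^{(3)}=(2,3,1)^T$, and for $k\ge 4$, if $b^{(k-1)}=(2,x_1,x_2,\dots,x_{k-3},1)^T$, then $$b^{(k)}=(2,\ 2+x_1,\ x_1+x_2,\ \dots,\ x_{k-4}+x_{k-3},\ x_{k-3}+1,\ 1)^T$$ (that is, the first and last entries are $2$ and $1$, and the intermediate entries are the sums of consecutive entries of $b^{(k-1)}$). (ii) If $N\ge 5$ is odd, then, with $k=\frac{N-1}{2}$, the $H_2$ norm of $(\ast)$ is equal to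 the $H_2$ norm of the system $$\dot\xi=\tilde A_o\xi+\tilde B_o w,\qquad y=\tilde C_o\xi ,$$ where $\tilde A_o=\mathrm{diag}(I_k\otimes A_1+J_k\otimes A_{12},\ A_1)$, $\tilde C_o=(C_k^{\,\mathrm{blk}},\ (-1)^{k}C_1)$, and $\tilde B_o=d^{(k)}\otimes B_1$, where $d^{(k)}\in\mathbf R^{k+1}$ is defined inductively by $d^{(2)}=(2,2,1)^T$, $d^{(3)}=(2,4,2,1)^T$, and for $k\ge 4$, if $d^{(k-1)}=(2,x_1,\dots,x_{k-3},2,1)^T$, then $$d^{(k)}=(2,\ 2+x_1,\ x_1+x_2,\ \dots,\ x_{k-4}+x_{k-3},\ x_{k-3}+2,\ 2,\ 1)^T .$$
   Context: $A_1\in\mathbf R^{n\times n}$, $B_1\in\mathbf R^{n\times m}$, $C_1\in\mathbf R^{m\times n}$ are constant matrices and $A_{12}=B_1C_1$. $\otimes$ is the Kronecker product, $I_k$ is the $k\times k$ identity, $E_N=(1,\dots,1)^T\in\mathbf R^N$. A square matrix is stable if all its eigenvalues have negative real part. The $H_2$ norm of a system $\dot\xi=A\xi+Bw,\ y=C\xi$ with $A$ stable is that of its transfer function $G(s)=C(sI-A)^{-1}B$, namely $\|G\|_2=\sqrt{\frac1{2\pi}\int_{-\infty}^{\infty}\mathrm{trace}\{G(j\omega)^HG(j\omega)\}\,d\omega}$. The outer coupling matrix $\Gamma=(\gamma_{ij})_{N\times N}$ is defined by: $\gamma_{ii}=0$; $\gamma_{ij}=-1$ if $j\le i-2$ and $j$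 is odd; and $\gamma_{ij}=1$ for all other $i\ne j$. $J_k$ is the $k\times k$ upper bidiagonal matrix with all diagonal entries equal to $1$ and all first-superdiagonal entries equal to $2$ (all other entries $0$). *)

(* Defs.v *)
From mathcomp Require Import all_boot all_order all_algebra.
From mathcomp Require Import complex mxtens.
From mathcomp Require Import all_classical all_reals all_analysis.

Set Implicit Arguments.
Unset Strict Implicit.
Unset Printing Implicit Defensive.

Import Order.TTheory GRing.Theory Num.Theory.
Import numFieldNormedType.Exports.

Local Open Scope ring_scope.
Local Open Scope complex_scope.

Definition cplx_mx (R : realType) (p q : nat) (M : 'M[R]_(p, q)) : 'M[R[i]]_(p, q) :=
  map_mx (real_complex R) M.

Definition conj_trmx (R : realType) (p q : nat) (M : 'M[R[i]]_(p, q)) : 'M[R[i]]_(q, p) :=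
  map_mx (@conjc R) M^T.

Definition stable (R : realType) (n : nat) (A : 'M[R]_n) : Prop :=
  forall z : R[i], eigenvalue (cplx_mx A) z -> complex.Re z < 0.

Definition transfer (R : realType) (n p q : nat) (A : 'M[R]_n) (B : 'M[R]_(n, p))
    (C : 'M[R]_(q, n)) (s : R[i]) : 'M[R[i]]_(q, p) :=
  cplx_mx C *m invmx (s%:M - cplx_mx A) *m cplx_mx B.

(* The trace of G^H G is a nonnegative real; Re only retypes it from R[i] to R. *)
Definition spectral_power (R : realType) (n p q : nat) (A : 'M[R]_n)
    (B : 'M[R]_(n, p)) (C : 'M[R]_(q, n)) (w : R) : R :=
  let G := transfer A B C (0 +i* w) in
  complex.Re (\tr (conj_trmx G *m G)).

(* Meaningful for stable A, where s%:M - A is invertible on the imaginary axis. *)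
Definition H2norm (R : realType) (n p q : nat) (A : 'M[R]_n) (B : 'M[R]_(n, p))
    (C : 'M[R]_(q, n)) : \bar R :=
  sqrte (((2 * pi)^-1)%:E *
    \int[@lebesgue_measure R]_(w in setT) (spectral_power A B C w)%:E)%E.

(* Ordinals start at 0, so the 1-based row and column numbers are i.+1, j.+1. *)
Definition outer_coupling (R : realType) (N : nat) : 'M[R]_N :=
  \matrix_(i < N, j < N)
    if i == j then 0
    else if (j.+1 + 2 <= i.+1)%N && odd j.+1 then -1
    else 1.

Definition bidiag (R : realType) (k : nat) : 'M[R]_k :=
  \matrix_(i < k, j < k)
    if i == j then 1 else if (j == i.+1 :> nat) then 2 else 0.

Definition block_row (R : realType) (p q k : nat) (s : seq 'M[R]_(p, q)) :
    'M[R]_(p, k * q) :=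
  \matrix_(i < p, j < k * q) (s`_(mxtens_unindex j).1) i (mxtens_unindex j).2.

(* The recursions below start at k = 2; their values at k = 0, 1 are dummies. *)

(* In the last clause, k = k'.+1 so that k' = k - 1 and k'.-1 = k - 2. *)
Fixpoint C_blocks (R : realType) (p q : nat) (C1 : 'M[R]_(p, q)) (k : nat) :
    seq 'M[R]_(p, q) :=
  match k with
  | 0 | 1 => [::]
  | 2 => [:: 2 *: C1; 0]
  | k'.+1 => rcons (C_blocks C1 k') (((-1) ^+ k' * 2 ^+ k'.-1) *: C1)
  end.

Definition C_row (R : realType) (p q : nat) (C1 : 'M[R]_(p, q)) (k : nat) :
    'M[R]_(p, k * q) :=
  block_row k (C_blocks C1 k).

Definition consecutive_sums (R : realType) (s : seq R) : seq R :=
  [seq xy.1 + xy.2 | xy <- zip s (behead s)].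

Fixpoint b_seq (R : realType) (k : nat) : seq R :=
  match k with
  | 0 | 1 => [::]
  | 2 => [:: 2; 1]
  | 3 => [:: 2; 3; 1]
  | k'.+1 => 2 :: rcons (consecutive_sums (b_seq R k')) 1
  end.

Definition b_vec (R : realType) (k : nat) : 'cV[R]_k := \col_(i < k) (b_seq R k)`_i.

(* d_seq k has k.+1 entries; take k' (d_seq k') is d_seq k' without its final 1. *)
Fixpoint d_seq (R : realType) (k : nat) : seq R :=
  match k with
  | 0 | 1 => [::]
  | 2 => [:: 2; 2; 1]
  | 3 => [:: 2; 4; 2; 1]
  | k'.+1 => 2 :: consecutive_sums (take k' (d_seq R k')) ++ [:: 2; 1]
  end.

Definition d_vec (R : realType) (k : nat) : 'cV[R]_k.+1 :=
  \col_(i < k.+1) (d_seq R k)`_i.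

Definition net_A (R : realType) (n m : nat) (A1 : 'M[R]_n) (B1 : 'M[R]_(n, m))
    (C1 : 'M[R]_(m, n)) (N : nat) : 'M[R]_(N * n) :=
  1%:M *t A1 + outer_coupling R N *t (B1 *m C1).

Definition E_vec (R : realType) (N : nat) : 'cV[R]_N := const_mx 1.

Definition net_B (R : realType) (n m : nat) (B1 : 'M[R]_(n, m)) (N : nat) :
    'M[R]_(N * n, 1 * m) :=
  E_vec R N *t B1.

Definition net_C (R : realType) (n m : nat) (C1 : 'M[R]_(m, n)) (N : nat) :
    'M[R]_(1 * m, N * n) :=
  (E_vec R N)^T *t C1.

Definition even_A (R : realType) (n m : nat) (A1 : 'M[R]_n) (B1 : 'M[R]_(n, m))
    (C1 : 'M[R]_(m, n)) (k : nat) : 'M[R]_(k * n) :=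
  1%:M *t A1 + bidiag R k *t (B1 *m C1).

Definition even_B (R : realType) (n m : nat) (B1 : 'M[R]_(n, m)) (k : nat) :
    'M[R]_(k * n, 1 * m) :=
  b_vec R k *t B1.

Definition even_C (R : realType) (n m : nat) (C1 : 'M[R]_(m, n)) (k : nat) :
    'M[R]_(m, k * n) :=
  C_row C1 k.

Definition odd_A (R : realType) (n m : nat) (A1 : 'M[R]_n) (B1 : 'M[R]_(n, m))
    (C1 : 'M[R]_(m, n)) (k : nat) : 'M[R]_(k * n + n) :=
  block_mx (even_A A1 B1 C1 k) 0 0 A1.

Definition odd_B (R : realType) (n m : nat) (B1 : 'M[R]_(n, m)) (k : nat) :
    'M[R]_(k * n + n, 1 * m) :=
  castmx (mulSnr k n, erefl) (d_vec R k *t B1).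

Definition odd_C (R : realType) (n m : nat) (C1 : 'M[R]_(m, n)) (k : nat) :
    'M[R]_(m, k * n + n) :=
  row_mx (C_row C1 k) ((-1) ^+ k *: C1).

(* Main.v *)
(** Vectors x with x_{2l-1} = x_{2l} for all l form a [Gamma]-invariant space
    containing [E_N], so the network input only excites the corresponding
    subsystem. On pair values, [Gamma] acts as I + 2V with V strictly upper
    triangular and all ones above the diagonal (for odd N, the unpaired last node
    adds a kernel vector of alternating signs). A suitable Jordan basis W of this
    space satisfies [Gamma W = W J], [W b = E_N] and [E_N^T W = c], where b and c are
    the input and output weights of the reduced system. Tensoring W with the
    identity intertwines the two systems, so that stability passes to the reduced
    system and both transfer functions agree on the imaginary axis. *)

Require Import Defs.
From mathcomp Require Import all_boot all_order all_algebra.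
From mathcomp Require Import all_classical all_reals all_analysis.
From mathcomp Require Import complex mxtens zify ring.

Set Implicit Arguments.
Unset Strict Implicit.
Unset Printing Implicit Defensive.

Import Order.TTheory GRing.Theory Num.Theory.

Local Open Scope ring_scope.

(** * State-space systems related by an intertwining matrix *)

Section Systems.
Variable R : realType.

Lemma eigenvalueN_unitmx (F : fieldType) n (A : 'M[F]_n) z :
  (z%:M - A \in unitmx) = ~~ eigenvalue A z.
Proof.
rewrite /eigenvalue /eigenspace kermx_eq0 negbK row_free_unit.
by rewrite -opprB -scaleN1r unitmxZ // unitrN unitr1.
Qed.

Lemma resolvent_intertwine (F : fieldType) n n' (A : 'M[F]_n) (A' : 'M[F]_n') T z :
  A *m T = T *m A' -> (z%:M - A) *m T = T *m (z%:M - A').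
Proof. by move=> AT; rewrite mulmxBl mulmxBr AT scalar_mxC. Qed.

(** When [z - A] is invertible, [L (z - A)^-1 T] is a left inverse of [z - A']; hence every
    eigenvalue of [A'] is one of [A]. *)
Lemma stable_intertwine n n' (A : 'M[R]_n) (A' : 'M[R]_n') T L :
  A *m T = T *m A' -> L *m T = 1%:M -> stable A -> stable A'.
Proof.
move=> /(congr1 (@cplx_mx _ _ _)) AT /(congr1 (@cplx_mx _ _ _)) LT sA z.
apply: contraLR => Rez.
have: ~~ eigenvalue (cplx_mx A) z by apply: contra Rez => /sA.
rewrite -!eigenvalueN_unitmx => uA.
move: AT LT; rewrite /cplx_mx !map_mxM map_mx1 => /(resolvent_intertwine z) AT LT.
suff /mulmx1_unit[]: (map_mx (real_complex R) L *m invmx (z%:M - cplx_mx A)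
     *m map_mx (real_complex R) T) *m (z%:M - cplx_mx A') = 1%:M by [].
by rewrite -mulmxA -AT mulmxA mulmxKV.
Qed.

(** Since [(z - A)^-1 T = T (z - A')^-1], the factor [T] moves from the input matrix to the output
    matrix. *)
Lemma transfer_intertwine n n' p q (A : 'M[R]_n) (B : 'M[R]_(n', p)) (C : 'M[R]_(q, n))
    (A' : 'M[R]_n') T z :
  A *m T = T *m A' -> ~~ eigenvalue (cplx_mx A) z -> ~~ eigenvalue (cplx_mx A') z ->
  transfer A (T *m B) C z = transfer A' B (C *m T) z.
Proof.
rewrite -!eigenvalueN_unitmx /transfer => /(congr1 (@cplx_mx _ _ _)).
rewrite /cplx_mx !map_mxM => /(resolvent_intertwine z) AT uA uA'.
rewrite -!mulmxA; congr (_ *m _).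
apply: (can_inj (mulKmx uA)); rewrite mulKVmx // !mulmxA AT.
by rewrite mulmxK.
Qed.

Lemma H2norm_intertwine n n' p q (A : 'M[R]_n) (B : 'M[R]_(n', p)) (C : 'M[R]_(q, n))
    (A' : 'M[R]_n') T :
  stable A -> stable A' -> A *m T = T *m A' ->
  H2norm A (T *m B) C = H2norm A' B (C *m T).
Proof.
move=> sA sA' AT; rewrite /H2norm.
suff -> : spectral_power A (T *m B) C = spectral_power A' B (C *m T) by [].
apply/funext => w.
have nA n0 (M : 'M[R]_n0) : stable M -> ~~ eigenvalue (cplx_mx M) (0 +i* w)%C.
  by move=> sM; apply/negP => /sM; rewrite ltxx.
by rewrite /spectral_power (transfer_intertwine _ _ AT) //; apply: nA.
Qed.

Lemma stable_castmx n n' (en : n = n') (A : 'M[R]_n) :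
  stable (castmx (en, en) A) <-> stable A.
Proof. by case: n' / en; rewrite castmx_id. Qed.

Lemma H2norm_castmx n n' p q q' (en : n = n') (eq : q = q') (A : 'M[R]_n)
    (B : 'M[R]_(n, p)) (C : 'M[R]_(q, n)) :
  H2norm (castmx (en, en) A) (castmx (en, erefl) B) (castmx (eq, en) C) =
  H2norm A B C.
Proof. by case: n' / en; case: q' / eq; rewrite !castmx_id. Qed.

Lemma tens1mx1 (S : pzRingType) p q : 1%:M *t 1%:M = 1%:M :> 'M[S]_(p * q).
Proof.
apply/matrixP => i j.
case: (mxtens_indexP i) => i0 i1; case: (mxtens_indexP j) => j0 j1.
rewrite tensmxE !mxE -natrM mulnb.
by rewrite (inj_eq (can_inj (@mxtens_indexK p q))) xpair_eqE.
Qed.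

Lemma reduced_network n m (A1 : 'M[R]_n) (B1 : 'M[R]_(n, m)) (C1 : 'M[R]_(m, n))
    N K (W : 'M[R]_(N, K)) L J b c :
  outer_coupling R N *m W = W *m J -> W *m b = E_vec R N ->
  (E_vec R N)^T *m W = c -> L *m W = 1%:M ->
  stable (net_A A1 B1 C1 N) ->
  stable (1%:M *t A1 + J *t (B1 *m C1)) /\
  H2norm (net_A A1 B1 C1 N) (net_B B1 N) (net_C C1 N) =
  H2norm (1%:M *t A1 + J *t (B1 *m C1)) (b *t B1) (c *t C1).
Proof.
move=> GW Wb EW LW sA.
have AT : net_A A1 B1 C1 N *m (W *t 1%:M) =
    (W *t 1%:M) *m (1%:M *t A1 + J *t (B1 *m C1)).
  by rewrite mulmxDl mulmxDr !tensmx_mul GW !mul1mx !mulmx1.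
have sA' : stable (1%:M *t A1 + J *t (B1 *m C1)).
  apply: (stable_intertwine (L := L *t 1%:M) AT _ sA).
  by rewrite tensmx_mul LW mul1mx tens1mx1.
have -> : net_B B1 N = (W *t 1%:M) *m (b *t B1) by rewrite tensmx_mul Wb mul1mx.
have -> : c *t C1 = net_C C1 N *m (W *t 1%:M) by rewrite tensmx_mul EW mulmx1.
by split; [exact: sA' | exact: H2norm_intertwine].
Qed.

End Systems.

(** * Jordan chain coefficients and their binomial sums *)

Section Chain.
Variable R : comNzRingType.

(* [chain_coef j l] is the coefficient of t^(j-l) in (1-t)^(j-1)/(1+t): the entry of
   the j-th Jordan chain vector at the l-th pair. It does not depend on the
   number of pairs. *)
Fixpoint chain_coef (j l : nat) : R :=
  match j, l with
  | 0, l => (l == 0)%:R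
  | j'.+1, 0 => (-1) ^+ j * 2 ^+ j'
  | j'.+1, l'.+1 => chain_coef j' l' - chain_coef j' l
  end.

Lemma chain_coef_gt j l : (j < l)%N -> chain_coef j l = 0.
Proof. by elim: j l => [|j IH] [|l] //= jl; rewrite !IH ?subrr //; lia. Qed.

Lemma chain_coef_diag j : chain_coef j j = 1.
Proof. by elim: j => [|j IH] //=; rewrite IH chain_coef_gt ?subr0. Qed.

(* V maps the chain vector j+1 to the chain vector j. *)
Lemma sum_chain_coefS j k l : (j < k)%N -> (l <= k)%N ->
  \sum_(l.+1 <= i < k.+1) chain_coef j.+1 i = chain_coef j l.
Proof.
move=> jk lk; rewrite big_add1 /=.
under eq_bigr do rewrite -opprB.
by rewrite sumrN telescope_sumr // opprB (chain_coef_gt jk) subr0.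
Qed.

(** From j = 1 on, column 0 doubles and changes sign at each step; the indicator corrects j = 0,
    where the entries are 1 and -1. *)
Lemma chain_coef_col0 j :
  chain_coef j 0 + chain_coef j.+1 0 = (j == 0)%:R - chain_coef j 0.
Proof. by case: j => [|j]; rewrite /= !exprS; ring. Qed.

(** By the binomial theorem, ((1-t)/t)^j weighted by C(n,j) sums to t^(-n), so the sum is the
    coefficient of t^(n-l) in 1/(1-t^2). The formal proof is an induction on n by Pascal's rule. *)
Lemma sum_bin_chain_coef n l :
  \sum_(j < n.+1) 'C(n, j)%:R * chain_coef j l = ((l <= n)%N && ~~ odd (n - l))%:R.
Proof.
elim: n l => [|n IH] l; first by rewrite big_ord1 bin0 mul1r; case: l.
have step : \sum_(j < n.+2) 'C(n.+1, j)%:R * chain_coef j l =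
    \sum_(j < n.+1) 'C(n, j)%:R * (chain_coef j l + chain_coef j.+1 l).
  under [RHS]eq_bigr do rewrite mulrDr.
  rewrite big_split big_ord_recl [X in _ = X + _]big_ord_recl !bin0 -addrA.
  congr (_ + _); under [LHS]eq_bigr do rewrite lift0 binS natrD mulrDl.
  rewrite big_split; congr (_ + _).
  rewrite big_ord_recr /= bin_small // mul0r addr0.
  by apply: eq_bigr => i _; rewrite /bump add1n.
(* In column 0 the paired terms give 1 minus the sum for n; in column l+1 they collapse to column l,
   which gives the sum for n and l. *)
rewrite step; case: l {step} => [|l].
  under eq_bigr do rewrite chain_coef_col0 mulrBr.
  rewrite sumrB IH subn0 big_ord_recl bin0 mulr1 big1 => [|j _]; last by rewrite mulr0.
  by rewrite /=; case: (odd n) => /=; ring.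
under eq_bigr do rewrite /= addrC subrK.
by rewrite IH subSS ltnS.
Qed.

(** The scalar in front of [C1] in block j of [C_row], counting blocks from 0. *)
Definition out_coef (j : nat) : R :=
  match j with
  | 0 => 2
  | 1 => 0
  | j'.+2 => (-1) ^+ j * 2 ^+ j'.+1
  end.

(** For j > 0 the entries past column 0 telescope to [chain_coef j.-1 0]. The factor 2 counts both
    nodes of a pair. *)
Lemma sum_chain_coef j k : (j < k)%N ->
  2 * \sum_(l < k) chain_coef j l = out_coef j.
Proof.
case: k => // k; rewrite big_ord_recl ltnS.
case: j => [|j] jk; first by rewrite big1 //= addr0 mulr1.
have -> : \sum_(i < k) chain_coef j.+1 (lift ord0 i) = chain_coef j 0.
  by rewrite -(sum_chain_coefS jk) // big_add1 big_mkord.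
by case: j jk => [|j] _; rewrite /= !exprS; ring.
Qed.

End Chain.

(** * Action of the coupling matrix on vectors constant on pairs *)

Section Coupling.
Variable R : realType.
Implicit Type h : nat -> R.

Lemma sum_half h N :
  \sum_(j < N) h j./2 = 2 * (\sum_(l < N./2) h l) + (odd N)%:R * h N./2.
Proof.
elim: N => [|N IH]; first by rewrite !big_ord0 /=; ring.
rewrite big_ord_recr IH /= uphalf_half.
by case: (odd N); rewrite /= ?big_ord_recr /=; ring.
Qed.

(** Node j = 2l satisfies j + 2 <= i exactly when l < [i./2], so each earlier pair contributes once.
    The [minn] allows induction on N with i fixed. *)
Lemma sum_odd_half h N i :
  \sum_(j < N) ((j.+2 <= i)%N && ~~ odd j)%:R * h j./2 =
  \sum_(l < minn (uphalf N) i./2) h l.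
Proof.
elim: N => [|N IH]; first by rewrite min0n !big_ord0.
rewrite big_ord_recr IH /= uphalf_half.
case: (boolP (odd N)) => oN; rewrite ?andbF ?mul0r ?addr0 //= andbT.
case: ltnP => iN; rewrite ?mul1r ?mul0r ?addr0.
  have [-> ->] : minn N./2 i./2 = N./2 /\ minn N./2.+1 i./2 = N./2.+1 by lia.
  by rewrite big_ord_recr.
by have -> : minn N./2.+1 i./2 = minn N./2 i./2 by lia.
Qed.

(** The result depends on i only through [i./2], which is the invariance of pair-constant
    vectors. *)
Lemma sum_outer_coupling h N (i : 'I_N) :
  \sum_j outer_coupling R N i j * h j./2 =
  2 * (\sum_(l < N./2) h l) + (odd N)%:R * h N./2 - h i./2 - 2 * \sum_(l < i./2) h l.
Proof.
have iN : minn (uphalf N) i./2 = i./2 by have := ltn_ord i; lia.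
have := sum_odd_half h N i; rewrite iN -sum_half => <-.
have -> : h i./2 = \sum_(j < N) (i == j)%:R * h j./2.
  rewrite (bigD1 i) //= eqxx mul1r big1 ?addr0 // => j ji.
  by rewrite eq_sym (negPf ji) mul0r.
(* 0-based, the entry (i, j) is 1 - [i = j] - 2 [j + 2 <= i and j even]. *)
rewrite mulr_sumr -!sumrB; apply: eq_bigr => j _; rewrite mxE /=.
rewrite addn2 ltnS; case: eqP => [-> | _]; first by rewrite ltnNge leqnSn /=; ring.
by case: (_ && _) => /=; ring.
Qed.

Lemma outer_coupling_chain N (i : 'I_N) j : (j < N./2)%N ->
  \sum_i' outer_coupling R N i i' * chain_coef R j i'./2 =
  chain_coef R j i./2 + (if j is j'.+1 then 2 * chain_coef R j' i./2 else 0).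
Proof.
move=> jN; have iN : (i./2 <= N./2)%N by have := ltn_ord i; lia.
rewrite sum_outer_coupling (chain_coef_gt _ jN) mulr0 addr0.
(* Rewrites the shifted term as 2V applied to chain vector j. The range includes [N./2], where the
   coefficient is 0, so that the unpaired node of an odd N is covered too. *)
have -> : (if j is j'.+1 then 2 * chain_coef R j' i./2 else 0) =
    2 * \sum_(i./2.+1 <= l < N./2.+1) chain_coef R j l.
  case: j jN => [|j] jN; last by rewrite sum_chain_coefS //; lia.
  by rewrite big_nat big1 ?mulr0 // => l /andP[il _]; rewrite /= gtn_eqF //; lia.
have : \sum_(0 <= l < N./2.+1) chain_coef R j l = \sum_(l < N./2) chain_coef R j l.
  by rewrite big_nat_recr //= (chain_coef_gt _ jN) addr0 big_mkord.
rewrite (big_cat_nat (leq0n _) (leqW iN)) /= [X in _ + X]big_ltn 1?ltnS // big_mkord => <-.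
by ring.
Qed.

Lemma sum_mul_eq h k j : (j < k)%N -> \sum_(i < k) h i * (i == j :> nat)%:R = h j.
Proof.
move=> jk; rewrite (bigD1 (Ordinal jk)) //= eqxx mulr1 big1 ?addr0 // => i ij.
by rewrite (_ : (i == j :> nat) = false) ?mulr0 //; apply/negbTE.
Qed.

Definition bidiag_coef (i j : nat) : R :=
  if i == j then 1 else if j == i.+1 then 2 else 0.

Lemma sum_bidiag_coef h k j : (j < k)%N ->
  \sum_(i < k) h i * bidiag_coef i j = h j + (if j is j'.+1 then 2 * h j' else 0).
Proof.
move=> jk; have bE i : bidiag_coef i j = (i == j)%:R + 2 * (i.+1 == j)%:R.
  rewrite /bidiag_coef (eq_sym j).
  case: (i =P j) => [->|_]; first by rewrite gtn_eqF //=; ring.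
  by case: eqP => _ /=; ring.
under eq_bigr do rewrite bE mulrDr mulrCA.
rewrite big_split /= sum_mul_eq // -mulr_sumr; congr (_ + _).
case: j jk {bE} => [|j] jk; first by rewrite big1 ?mulr0 // => i _; rewrite mulr0.
by under eq_bigr do rewrite eqSS; rewrite sum_mul_eq // ltnW.
Qed.

(** The rows 2l, one per pair, form a unitriangular matrix [U]; its inverse composed with the
    selection [S] of these rows is the left inverse. *)
Lemma left_inverse_trig N K (x : nat -> nat -> R) :
  (K <= uphalf N)%N -> (forall j, x j j = 1) ->
  (forall j l, (j < l < K)%N -> x j l = 0) ->
  exists L, L *m (\matrix_(i < N, j < K) x j i./2) = 1%:M.
Proof.
move=> KN x1 x0; pose W := \matrix_(i < N, j < K) x j i./2.
pose S : 'M[R]_(K, N) := \matrix_(l, i) (i == l.*2 :> nat)%:R.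
pose U : 'M[R]_K := \matrix_(l, j) x j l.
have SW : S *m W = U.
  apply/matrixP => l j; rewrite !mxE; have lN : (l.*2 < N)%N by have := ltn_ord l; lia.
  rewrite -[in RHS](doubleK l) -(sum_mul_eq (fun i => x j i./2) lN).
  by apply: eq_bigr => i _; rewrite !mxE mulrC.
have uU : U \in unitmx.
  rewrite unitmxE -det_tr det_trig.
    by rewrite big1 ?unitr1 // => i _; rewrite !mxE.
  by apply/is_trig_mxP => i j ij; rewrite !mxE x0 // ij /=.
by exists (invmx U *m S); rewrite -mulmxA SW mulVmx.
Qed.

End Coupling.

(** * Closed forms of the inductively defined weights *)

Section Sequences.
Variable R : realType.

Lemma size_consecutive_sums (s : seq R) : size (consecutive_sums s) = (size s).-1.
Proof. by rewrite size_map size_zip size_behead; apply/minn_idPr/leq_pred. Qed.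

Lemma nth_consecutive_sums (s : seq R) j : (j.+1 < size s)%N ->
  (consecutive_sums s)`_j = s`_j + s`_j.+1.
Proof. by elim: s j => [|x [|y s] IH] [|j] //= js; rewrite -IH. Qed.

(** The separately listed case of length 3 obeys the general recursion, so one induction
    suffices. *)
Lemma b_seqS k : b_seq R k.+3 = 2 :: rcons (consecutive_sums (b_seq R k.+2)) 1.
Proof. by case: k => //=; congr [:: _; _; _]; ring. Qed.

(** The recursion is Pascal's rule applied to the sum of two consecutive rows. *)
Lemma b_seqE k : size (b_seq R k.+2) = k.+2 /\
  forall j, (b_seq R k.+2)`_j = ('C(k, j) + 'C(k.+1, j))%:R.
Proof.
elim: k => [|k [szk IH]].
  by split=> // -[|[|j]] //=; rewrite ?nth_nil ?bin_small.
rewrite b_seqS; move: (b_seq _ _) szk IH => s szk IH.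
split=> [|[|j]]; rewrite /= ?size_rcons ?size_consecutive_sums ?szk //.
rewrite nth_rcons size_consecutive_sums szk /=.
case: ltngtP => jk.
- rewrite nth_consecutive_sums ?szk // !IH !binS; ring.
- by rewrite !bin_small //; lia.
- by rewrite jk bin_small // binn.
Qed.

Lemma d_seqS k : d_seq R k.+3 =
  2 :: consecutive_sums (take k.+2 (d_seq R k.+2)) ++ [:: 2; 1].
Proof. by case: k => //=; congr [:: _; _; _; _]; ring. Qed.

(** Twice a row of Pascal's triangle, followed by the weight 1 of the kernel vector. *)
Lemma d_seqE k : [/\ size (d_seq R k.+2) = k.+3, (d_seq R k.+2)`_k.+2 = 1 &
  forall j, (j < k.+2)%N -> (d_seq R k.+2)`_j = 2 * 'C(k.+1, j)%:R].
Proof.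
elim: k => [|k [szk _ IH]].
  by split=> // -[|[|j]] //= _; rewrite mulr1.
rewrite d_seqS; move: (d_seq _ _) szk IH => s szk IH.
have szt : size (consecutive_sums (take k.+2 s)) = k.+1.
  by rewrite size_consecutive_sums size_takel ?szk.
split=> [||[|j] jk] /=; rewrite ?size_cat ?szt ?addn2 //.
- by rewrite nth_cat szt ltnNge leqnSn /= subSnn.
- by rewrite bin0 mulr1.
rewrite nth_cat szt; case: ltngtP => jk' //=.
- rewrite nth_consecutive_sums ?size_takel ?szk // !nth_take; try by lia.
  by rewrite !IH ?binS ?natrD; [ring | lia..].
- by lia.
- by rewrite jk' subnn binn mulr1.
Qed.

Lemma C_blocksE p q (C1 : 'M[R]_(p, q)) k : size (C_blocks C1 k.+2) = k.+2 /\
  forall j, (j < k.+2)%N -> (C_blocks C1 k.+2)`_j = out_coef R j *: C1.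
Proof.
elim: k => [|k [szk IH]]; first by split=> // -[|[|j]] //= _; rewrite scale0r.
have -> : C_blocks C1 k.+3 =
  rcons (C_blocks C1 k.+2) (((-1) ^+ k.+2 * 2 ^+ k.+1) *: C1) by [].
split=> [|j jk]; first by rewrite size_rcons szk.
rewrite nth_rcons szk; case: ltngtP => jk'; [exact: IH | lia | by rewrite jk'].
Qed.

End Sequences.

(** * The bases W for even and odd N *)

Section Intertwiners.
Variable R : realType.

Lemma left_row_sum N K (x : nat -> nat -> R) (j : 'I_K) :
  ((E_vec R N)^T *m \matrix_(i < N, j < K) x j i./2) 0 j =
  2 * (\sum_(l < N./2) x j l) + (odd N)%:R * x j N./2.
Proof.
by rewrite -sum_half mxE; apply: eq_bigr => i _; rewrite !mxE mul1r.
Qed.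

Lemma sum_sign_sub k l : (l <= k)%N ->
  2 * \sum_(i < l) (-1) ^+ (k - i) = (-1) ^+ k - (-1) ^+ (k - l) :> R.
Proof.
elim: l => [|l IH] lk; first by rewrite big_ord0 subn0 subrr mulr0.
by rewrite big_ord_recr mulrDr IH 1?ltnW //= -(subnSK lk) exprS; ring.
Qed.

Definition even_basis N : 'M[R]_(N, N./2) :=
  \matrix_(i < N, j < N./2) chain_coef R j i./2.

Lemma even_basis_coupling N :
  outer_coupling R N *m even_basis N = even_basis N *m bidiag R N./2.
Proof.
apply/matrixP => i j; rewrite !mxE.
under eq_bigr do rewrite [X in _ * X]mxE.
under [RHS]eq_bigr do rewrite !mxE.
by rewrite outer_coupling_chain // -(sum_bidiag_coef (chain_coef R ^~ i./2) (ltn_ord j)).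
Qed.

(** The two Pascal rows in b give the indicators of complementary parities, which add up to 1 at
    every pair. *)
Lemma even_basis_input N : ~~ odd N -> (4 <= N)%N ->
  even_basis N *m b_vec R N./2 = E_vec R N.
Proof.
move=> eN N4; apply/matrixP => i j; rewrite !mxE.
under eq_bigr do rewrite !mxE.
have: (i./2 < N./2)%N by have := ltn_ord i; lia.
have [k ->] : exists k, N./2 = k.+2 by exists (N./2 - 2)%N; lia.
have [_ bE] := b_seqE R k; rewrite ltnS => ik.
under eq_bigr do rewrite bE natrD mulrC mulrDl.
rewrite big_split sum_bin_chain_coef big_ord_recr /= bin_small // mul0r addr0.
rewrite sum_bin_chain_coef ik.
case: (ltngtP i./2 k.+1) ik => //= [ik _ | -> _]; last by rewrite ltnn subnn add0r.
rewrite ltnS in ik; rewrite ik subSn //=; case: (odd _) => /=; ring.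
Qed.

Lemma even_basis_output N : ~~ odd N ->
  (E_vec R N)^T *m even_basis N = \row_j out_coef R j.
Proof.
move=> /negPf eN; apply/rowP => j.
by rewrite left_row_sum eN mul0r addr0 sum_chain_coef // mxE.
Qed.

(** Column k is the alternating kernel vector, normalised to 1 at the unpaired node l = k. *)
Definition odd_coef k j l : R :=
  if (j < k)%N then chain_coef R j l else (-1) ^+ (k - l).

Definition odd_basis N : 'M[R]_(N, N./2.+1) :=
  \matrix_(i < N, j < N./2.+1) odd_coef N./2 j i./2.

(** J bordered by a zero row and a zero column, since the kernel vector is outside the chain. *)
Definition odd_bidiag k : 'M[R]_k.+1 :=
  \matrix_(i < k.+1, j < k.+1)
    if (i < k)%N && (j < k)%N then bidiag_coef R i j else 0.

Lemma odd_basis_coupling N : odd N ->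
  outer_coupling R N *m odd_basis N = odd_basis N *m odd_bidiag N./2.
Proof.
move=> oN; apply/matrixP => i j; rewrite !mxE.
under eq_bigr do rewrite [X in _ * X]mxE.
under [RHS]eq_bigr do rewrite !mxE.
rewrite big_ord_recr /= ltnn mulr0 addr0 {1}/odd_coef.
case: ltnP => jN.
  under [RHS]eq_bigr do rewrite ltn_ord /odd_coef ltn_ord.
  by rewrite outer_coupling_chain // -(sum_bidiag_coef (chain_coef R ^~ i./2) jN).
have iN : (i./2 <= N./2)%N by have := ltn_ord i; lia.
(* With K = [N./2] and l = [i./2], the doubled sums are (-1)^K - 1 and (-1)^K - (-1)^(K-l); the
   single terms 1 and (-1)^(K-l) cancel their difference. *)
rewrite (sum_outer_coupling (fun l => (-1) ^+ (N./2 - l))) !sum_sign_sub // oN subnn.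
by rewrite big1 => [|l _]; rewrite ?andbF ?mulr0 //=; ring.
Qed.

(** At a pair, twice a parity indicator plus the opposite sign is 1; at the unpaired node only the
    kernel vector contributes. *)
Lemma odd_basis_input N : odd N -> (4 <= N)%N ->
  odd_basis N *m d_vec R N./2 = E_vec R N.
Proof.
move=> oN N4; apply/matrixP => i j; rewrite !mxE.
under eq_bigr do rewrite !mxE.
have: (i./2 <= N./2)%N by have := ltn_ord i; lia.
have [k ->] : exists k, N./2 = k.+2 by exists (N./2 - 2)%N; lia.
have [_ dmax dE] := d_seqE R k => ik.
rewrite big_ord_recr /= dmax mulr1 {2}/odd_coef ltnn.
under eq_bigr => l _ do
  rewrite dE // /odd_coef ltn_ord mulrC -mulrA.
rewrite -mulr_sumr sum_bin_chain_coef.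
case: ltngtP ik => //= [ik _ | -> _]; last by rewrite subnn ltnn /=; ring.
rewrite -ltnS ik (subSn (_ : _ <= k.+1)%N) // exprS -signr_odd.
by case: (odd _) => /=; ring.
Qed.

Lemma odd_basis_output N : odd N ->
  (E_vec R N)^T *m odd_basis N =
  \row_j (if (j < N./2)%N then out_coef R j else (-1) ^+ N./2).
Proof.
move=> oN; apply/rowP => j.
rewrite left_row_sum oN mul1r /odd_coef mxE; case: ltnP => jN.
  by rewrite sum_chain_coef // chain_coef_gt ?addr0.
by rewrite sum_sign_sub // subnn; ring.
Qed.

End Intertwiners.

(** * Identification of the Kronecker forms with the stated block matrices *)

Section Casts.
Variable R : realType.

Lemma cast_ord_mul1n m (i : 'I_m) :
  cast_ord (esym (mul1n m)) i = mxtens_index (ord0 : 'I_1, i).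
Proof. exact: val_inj. Qed.

Lemma cast_ord_mulSnr_lshift k n (i : 'I_k) (j : 'I_n) :
  cast_ord (esym (mulSnr k n)) (lshift n (mxtens_index (i, j))) =
  mxtens_index (widen_ord (leqnSn k) i, j).
Proof. exact: val_inj. Qed.

Lemma cast_ord_mulSnr_rshift k n (j : 'I_n) :
  cast_ord (esym (mulSnr k n)) (rshift (k * n) j) = mxtens_index (ord_max, j).
Proof. exact: val_inj. Qed.

Lemma C_rowE p q (C1 : 'M[R]_(p, q)) k i j l :
  C_row C1 k.+2 i (mxtens_index (j, l)) = out_coef R j * C1 i l.
Proof. by rewrite mxE mxtens_indexK /= (proj2 (C_blocksE C1 k)) // mxE. Qed.

Variables (n m : nat) (A1 : 'M[R]_n) (B1 : 'M[R]_(n, m)) (C1 : 'M[R]_(m, n)).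

Lemma even_CE k : (1 < k)%N ->
  even_C C1 k = castmx (mul1n m, erefl) ((\row_(j < k) out_coef R j) *t C1).
Proof.
case: k => [|[|k]] // _; apply/matrixP => i j; case: (mxtens_indexP j) => j0 j1.
by rewrite /even_C C_rowE castmxE cast_ord_id cast_ord_mul1n tensmxE mxE.
Qed.

(** In the last diagonal block [odd_bidiag] vanishes, and the identity factor leaves [A1]. *)
Lemma odd_AE k : odd_A A1 B1 C1 k =
  castmx (mulSnr k n, mulSnr k n) (1%:M *t A1 + odd_bidiag R k *t (B1 *m C1)).
Proof.
apply/matrixP => i j; rewrite castmxE [RHS]mxE.
case: (split_ordP i) => a ->; case: (split_ordP j) => b ->.
- rewrite block_mxEul; case: (mxtens_indexP a) => a0 a1.
  case: (mxtens_indexP b) => b0 b1.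
  by rewrite !cast_ord_mulSnr_lshift [LHS]mxE !tensmxE !mxE /= !ltn_ord.
- rewrite block_mxEur; case: (mxtens_indexP a) => a0 a1.
  rewrite cast_ord_mulSnr_lshift cast_ord_mulSnr_rshift !tensmxE !mxE /= ltnn andbF.
  by rewrite -val_eqE /= ltn_eqF //=; ring.
- rewrite block_mxEdl; case: (mxtens_indexP b) => b0 b1.
  rewrite cast_ord_mulSnr_lshift cast_ord_mulSnr_rshift !tensmxE !mxE /= ltnn.
  by rewrite -val_eqE /= gtn_eqF //=; ring.
- rewrite block_mxEdr !cast_ord_mulSnr_rshift !tensmxE !mxE /= ltnn eqxx.
  by rewrite /=; ring.
Qed.

Lemma odd_CE k : (1 < k)%N -> odd_C C1 k =
  castmx (mul1n m, mulSnr k n)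
    ((\row_(j < k.+1) (if (j < k)%N then out_coef R j else (-1) ^+ k)) *t C1).
Proof.
case: k => [|[|k]] // _; apply/matrixP => i j.
rewrite castmxE cast_ord_mul1n; case: (split_ordP j) => a ->.
  rewrite row_mxEl; case: (mxtens_indexP a) => a0 a1.
  by rewrite C_rowE cast_ord_mulSnr_lshift tensmxE mxE /= ltn_ord.
by rewrite row_mxEr cast_ord_mulSnr_rshift tensmxE !mxE /= ltnn.
Qed.

End Casts.

Theorem theorem1 (R : realType) (n m : nat)
    (A1 : 'M[R]_n) (B1 : 'M[R]_(n, m)) (C1 : 'M[R]_(m, n))
    (N : nat) (hN : (4 <= N)%N)
    (hstable : stable (net_A A1 B1 C1 N)) :
  (~~ odd N ->
     let k := (N %/ 2)%N in
     stable (even_A A1 B1 C1 k) /\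
     H2norm (net_A A1 B1 C1 N) (net_B B1 N) (net_C C1 N) =
     H2norm (even_A A1 B1 C1 k) (even_B B1 k) (even_C C1 k)) /\
  ((5 <= N)%N -> odd N ->
     let k := ((N - 1) %/ 2)%N in
     stable (odd_A A1 B1 C1 k) /\
     H2norm (net_A A1 B1 C1 N) (net_B B1 N) (net_C C1 N) =
     H2norm (odd_A A1 B1 C1 k) (odd_B B1 k) (odd_C C1 k)).
Proof.
have k1 : (1 < N./2)%N by lia.
split=> [eN | _ oN]; cbv zeta.
  have -> : (N %/ 2 = N./2)%N by rewrite divn2.
  have [L LW] : exists L, L *m even_basis R N = 1%:M.
    apply: left_inverse_trig => [|j|j l /andP[jl _]]; first by lia.
      exact: chain_coef_diag.
    exact: chain_coef_gt.
  have [sA ->] := reduced_network (even_basis_coupling R N)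
    (even_basis_input R eN hN) (even_basis_output R eN) LW hstable.
  split; first exact: sA.
  by rewrite even_CE // -(H2norm_castmx erefl (mul1n m)) !castmx_id.
have -> : ((N - 1) %/ 2 = N./2)%N by rewrite divn2; lia.
have [L LW] : exists L, L *m odd_basis R N = 1%:M.
  apply: left_inverse_trig => [|j|j l /andP[jl lN]]; first by lia.
    rewrite /odd_coef; case: ltnP => jN; first exact: chain_coef_diag.
    (* Truncated subtraction makes the exponent 0 for every j >= [N./2], so the diagonal condition
       holds beyond the matrix as well. *)
    by rewrite (eqP (jN : N./2 - j == 0)%N).
  rewrite /odd_coef ifT; [exact: chain_coef_gt | lia].
have [sA ->] := reduced_network (odd_basis_coupling R oN)
  (odd_basis_input R oN hN) (odd_basis_output R oN) LW hstable.
rewrite odd_AE odd_CE //; split; first exact/stable_castmx.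
by rewrite H2norm_castmx.
Qed.
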